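(* Let $F=(F_n)_n$ be a family of unsatisfiable CNF formulas, $F_n$ over $n$ variables with every clause containing at most $\mathrm{polylog}(n)$ literals. Then $\mathrm{Search}_F\in\mathsf{TFZPP}^{dt}$ if and only if $F_n$ has a random tree-like resolution proof of complexity $\mathrm{polylog}(n)$ (equivalently, of width $\mathrm{polylog}(n)$ and quasi-polynomial size).
   Context: For an unsatisfiable CNF $F_n=C_1\wedge\dots\wedge C_m$ over $n$ variables, $\mathrm{Search}_{F_n}$ is the query search problem: given $x\in\{0,1\}^n$ (accessed by bit queries), output an index $o$ with $C_o(x)=0$. $\mathrm{Search}_F\in\mathsf{TFZPP}^{dt}$ means: for every $n$ there is a distribution over decision trees of depth $\mathrm{polylog}(n)$ on $\{0,1\}^n$ with leaves labelled by clause indices or $\bot$ such that for every $x$ and every tree $A$ in the support, $A(x)\ne\bot$ implies $C_{A(x)}(x)=0$, and $\Pr[A(x)=\bot]\le 1/3$. A resolution refutation of a CNF is a sequence of clauses ending with the empty clause, each either in the CNF or obtained from two earlier clauses $A\vee x$, $B\vee\bar x$ by deriving $A\vee B$; it is tree-like if each clause is used at most once as a premise. Its size is the number of clauses and its width the maximum number of literals in a clause. A random tree-like resolution proof of $F_n$ is a distribution $\mathcal D$ over pairs $(\Pi,B)$ where $B$ is a CNF over the variables of $F_n$, $\Pi$ is a tree-like resolution refutation of $F_n\wedge B$, and for every assignment $x\in\{0,1\}^n$, $\Pr_{(\Pi,B)\sim\mathcal D}[B(x)=1]\ge 2/3$. Its complexity is $\max_{(\Pi,B)} \mathrm{width}(\Pi)+\max_{(\Pi,B)}\log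 \mathrm{size}(\Pi)$ over the support. *)

(* Defs.v *)
From HB Require Import structures.
From mathcomp Require Import all_boot all_order all_algebra finmap reals.

Set Implicit Arguments.
Unset Strict Implicit.
Unset Printing Implicit Defensive.

Import Order.TTheory GRing.Theory Num.Theory.

(* [up_log 2 n] is log_2 n rounded up; [polylog] reads f(n) = (log n)^O(1). *)

Definition polylog (f : nat -> nat) : Prop :=
  exists c k N : nat, forall n, N <= n -> f n <= c * up_log 2 n ^ k.

Definition quasipoly (f : nat -> nat) : Prop :=
  exists2 p, polylog p & forall n, f n <= 2 ^ p n.

(* Finitely supported distributions.  There are only finitely many decision   *)
(* trees of a given depth over n variables, and likewise only finitely many   *)
(* proofs of a given size and auxiliary CNFs up to repetition and reordering  *)
(* of clauses, so nothing is lost with respect to arbitrary distributions.    *)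

Record fdist (R : realType) (T : choiceType) := FDist {
  pmf :> {fsfun T -> R with 0%R};
  pmf_ge0 : forall t, (0 <= pmf t)%R;
  pmf_sum1 : (\sum_(t <- finsupp pmf) pmf t = 1)%R
}.

Definition Pr (R : realType) (T : choiceType) (D : fdist R T) (E : pred T) : R :=
  (\sum_(t <- finsupp D | E t) D t)%R.

(* The literal (i, true) is the variable x_i, and (i, false) its negation. *)

Definition literal (n : nat) := ('I_n * bool)%type.
Definition clause (n : nat) := {set literal n}.
Definition cnf (n : nat) := seq (clause n).

Section Semantics.
Variable n : nat.
Implicit Types (x : n.-tuple bool) (C : clause n) (F : cnf n).

Definition clause_eval C x : bool := [exists l in C, tnth x l.1 == l.2].

Definition cnf_eval F x : bool := all (clause_eval^~ x) F.

Definition unsatisfiable F : Prop := forall x, ~~ cnf_eval F x.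

Definition width (s : seq (clause n)) : nat := \max_(C <- s) #|C|.

End Semantics.

(* In [Query i t0 t1] the subtree t0 is followed if x_i = 0, and t1 if        *)
(* x_i = 1; [Leaf None] is the leaf labelled by bottom.                       *)

Inductive dtree (n : nat) (O : Type) : Type :=
| Leaf of option O
| Query of 'I_n & dtree n O & dtree n O.

Arguments Leaf {n O}.

Section DtreeChoice.
Variables (n : nat) (O : choiceType).

Fixpoint dtree_encode (t : dtree n O) : GenTree.tree ('I_n + option O) :=
  match t with
  | Leaf o => GenTree.Leaf (inr o)
  | Query i t0 t1 =>
      GenTree.Node 0 [:: GenTree.Leaf (inl i); dtree_encode t0; dtree_encode t1]
  end.

Fixpoint dtree_decode (g : GenTree.tree ('I_n + option O)) :
    option (dtree n O) :=
  match g with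
  | GenTree.Leaf (inr o) => Some (Leaf o)
  | GenTree.Node 0 [:: GenTree.Leaf (inl i); g0; g1] =>
      match dtree_decode g0, dtree_decode g1 with
      | Some t0, Some t1 => Some (Query i t0 t1)
      | _, _ => None
      end
  | _ => None
  end.

Lemma dtree_encodeK : pcancel dtree_encode dtree_decode.
Proof. by elim=> [o|i t0 IH0 t1 IH1] //=; rewrite IH0 IH1. Qed.

HB.instance Definition _ := Choice.copy (dtree n O) (pcan_type dtree_encodeK).

End DtreeChoice.

Fixpoint dtree_eval n O (t : dtree n O) (x : n.-tuple bool) : option O :=
  match t with
  | Leaf o => o
  | Query i t0 t1 => if tnth x i then dtree_eval t1 x else dtree_eval t0 x
  end.

Fixpoint depth n O (t : dtree n O) : nat :=
  match t with
  | Leaf _ => 0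
  | Query _ t0 t1 => (maxn (depth t0) (depth t1)).+1
  end.

(* A query search problem on n-bit inputs with outputs in O: [S x o] holds    *)
(* if o is a correct answer on x.                                             *)
Definition search_problem (n : nat) (O : Type) := n.-tuple bool -> pred O.

Definition Search n (F : cnf n) : search_problem n 'I_(size F) :=
  fun x o => ~~ clause_eval (nth set0 F o) x.

Arguments Search {n} F x o.

Definition TFZPPdt (R : realType) (O : nat -> choiceType)
    (S : forall n, search_problem n (O n)) : Prop :=
  exists2 D : forall n, fdist R (dtree n (O n)),
    polylog (fun n => \max_(A <- finsupp (D n)) depth A)
  & forall n (x : n.-tuple bool),
      (forall A, A \in finsupp (D n) ->
         forall o, dtree_eval A x = Some o -> S n x o)
      /\ (Pr (D n) (fun A => dtree_eval A x == None) <= 1 / 3)%R.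

Section Resolution.
Variable n : nat.
Implicit Types (F B : cnf n) (C : clause n) (p : seq (clause n)).

Definition resolvent C1 C2 C : Prop :=
  exists (i : 'I_n) (A1 A2 : clause n),
    [/\ C1 = (i, true) |: A1, C2 = (i, false) |: A2 & C = A1 :|: A2].

(* [J] justifies each line k of p: [J k = None] if the k-th clause is taken   *)
(* from F, and [J k = Some (i, j)] if it is resolved from lines i and j.      *)
Definition justification F p (J : nat -> option (nat * nat)) : Prop :=
  forall k, k < size p ->
    match J k with
    | None => nth set0 p k \in F
    | Some (i, j) =>
        [/\ i < k, j < k & resolvent (nth set0 p i) (nth set0 p j) (nth set0 p k)]
    end.

(* With multiplicity, so that [uniq (premises p J)] says that p is tree-like. *)
Definition premises p (J : nat -> option (nat * nat)) : seq nat :=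
  let ij := pmap J (iota 0 (size p)) in unzip1 ij ++ unzip2 ij.

Definition treelike_refutation F p : Prop :=
  (exists p', p = rcons p' set0)
  /\ exists2 J, justification F p J & uniq (premises p J).

Variable R : realType.

Implicit Type D : fdist R (seq (clause n) * cnf n)%type.

Definition random_treelike_proof F D : Prop :=
  (forall pB, pB \in finsupp D -> treelike_refutation (F ++ pB.2) pB.1)
  /\ forall x : n.-tuple bool, (2 / 3 <= Pr D (fun pB => cnf_eval pB.2 x))%R.

Definition max_width D : nat := \max_(pB <- finsupp D) width pB.1.
Definition max_size D : nat := \max_(pB <- finsupp D) size pB.1.

Definition complexity D : nat :=
  max_width D + \max_(pB <- finsupp D) up_log 2 (size pB.1).

End Resolution.

(* Main.v *)
(* From left to right, a decision tree that never errs becomes a tree-like    *)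
(* resolution refutation once the negated path of every bottom leaf is added  *)
(* to B: at any other leaf the output clause, being falsified by every input  *)
(* that follows the path, is contained in the negated path.  Then B(x) = 0    *)
(* only if the tree fails on x.                                               *)
(* From right to left, unfold the refutation into a tree and search it for a  *)
(* falsified leaf: testing the clause at a lowest node that carries more than *)
(* half of the leaves, and then that of a child, halves the number of leaves, *)
(* so O(width * log size) queries suffice.  The answer is bottom only if the  *)
(* leaf that is found is a clause of B.                                       *)

Require Import Defs.
From mathcomp Require Import all_boot all_order all_algebra finmap reals.
From mathcomp Require Import boolp zify lra.

Set Implicit Arguments.
Unset Strict Implicit.
Unset Printing Implicit Defensive.

Import Order.TTheory GRing.Theory Num.Theory.

(** Both directions convert each sample of the distribution separately, so the core is deterministic
    and [fdist_transport] carries the probabilities over. [dtree_derivation] reads a decision tree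
    from its leaves to its root: every subtree yields a clause contained in the negated path to it,
    and each query costs at most one resolution step. Thus depth bounds both width and log size.
    Conversely, tree-likeness bounds the leaves of the unfolded refutation by its size
    ([treelike_unfold]), and [rtree_search] halves them with at most 2 * width queries. Throughout,
    the conclusion of the current tree is false at x and its cut-off leaves are true there, so by
    soundness an input leaf is false. In the first direction an answer of the tree at x implies B(x)
    = 1, in the second B(x) = 1 implies an answer; this matches the error 1/3 with the bound 2/3. *)

(** * Closure properties of polylogarithmic growth *)

Lemma polylog_le (f g : nat -> nat) :
  (forall n, f n <= g n) -> polylog g -> polylog f.
Proof.
move=> fg [c [k [N gP]]]; exists c, k, N => n Nn.
exact: leq_trans (fg n) (gP n Nn).
Qed.

Lemma polylog_cst (a : nat) : polylog (fun _ => a).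
Proof. by exists a, 0, 0 => n _; rewrite expn0 muln1. Qed.

Lemma polylogD (f g : nat -> nat) :
  polylog f -> polylog g -> polylog (fun n => f n + g n).
Proof.
move=> [c [k [N fP]]] [c' [k' [N' gP]]].
(* From n = 2 on the logarithm is at least 1, so both exponents may be raised to [k + k']. *)
exists (c + c'), (k + k'), (maxn 2 (maxn N N')) => n.
rewrite !geq_max => /and3P[n2 Nn N'n].
have L0 : 0 < up_log 2 n by rewrite up_log_gt0.
rewrite mulnDl; apply: leq_add.
- apply: leq_trans (fP n Nn) _; rewrite leq_mul2l; apply/orP; right.
  by rewrite leq_pexp2l // leq_addr.
- apply: leq_trans (gP n N'n) _; rewrite leq_mul2l; apply/orP; right.
  by rewrite leq_pexp2l // leq_addl.
Qed.

Lemma polylogM (f g : nat -> nat) :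
  polylog f -> polylog g -> polylog (fun n => f n * g n).
Proof.
move=> [c [k [N fP]]] [c' [k' [N' gP]]].
exists (c * c'), (k + k'), (maxn N N') => n.
rewrite geq_max => /andP[Nn N'n].
by rewrite expnD mulnACA leq_mul ?fP ?gP.
Qed.

(** * Clauses, soundness, and composition of tree-like derivations *)

Section Resolvents.
Variable n : nat.
Implicit Types (x : n.-tuple bool) (C P : clause n) (F B : cnf n).
Implicit Types (p q : seq (clause n)).

Lemma clause_evalPn C x :
  reflect (forall l, l \in C -> tnth x l.1 = ~~ l.2) (~~ clause_eval C x).
Proof.
apply: (iffP existsPn) => CF l.
- by move=> lC; have := CF l; rewrite lC /=; case: (tnth x l.1); case: (l.2).
- by apply/negP => /andP[/CF->]; case: (l.2).
Qed.

Lemma clause_eval_subset C1 C2 x :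
  C1 \subset C2 -> clause_eval C1 x -> clause_eval C2 x.
Proof.
move=> /subsetP C12 /existsP[l /andP[/C12 lC xl]].
by apply/existsP; exists l; rewrite lC.
Qed.

Lemma clause_eval_set0 x : clause_eval set0 x = false.
Proof. by apply/negbTE/clause_evalPn => l; rewrite inE. Qed.

Lemma clause_evalU1 l P x :
  clause_eval (l |: P) x = (tnth x l.1 == l.2) || clause_eval P x.
Proof.
apply/existsP/orP => [[l' /andP[/setU1P[->|l'P] xl']]|].
- by left.
- by right; apply/existsP; exists l'; rewrite l'P.
move=> [xl|/existsP[l' /andP[l'P xl']]].
- by exists l; rewrite setU11.
- by exists l'; rewrite inE l'P orbT.
Qed.

Lemma resolvent_sound C1 C2 C x : resolvent C1 C2 C ->
  clause_eval C1 x -> clause_eval C2 x -> clause_eval C x.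
Proof.
move=> [i [A1 [A2 [-> -> ->]]]]; rewrite !clause_evalU1 /=.
case: (tnth x i) => /=.
- by move=> _; apply: clause_eval_subset; exact: subsetUr.
- by move=> A1x _; apply: clause_eval_subset A1x; exact: subsetUl.
Qed.

(** If a literal (i, b) of [C] were missing from [P], the input that falsifies [P] and takes the
    value b wherever (j, b) is not in [P] would satisfy [C]. Such an input exists because [P] has no
    complementary literals. *)
Lemma falsified_subset C P :
  (forall i, ~~ (((i, true) \in P) && ((i, false) \in P))) ->
  (forall x, ~~ clause_eval P x -> ~~ clause_eval C x) -> C \subset P.
Proof.
move=> consP CP; apply/subsetP => -[i b] lC; apply: contraT => lP.
pose x : n.-tuple bool := [tuple if (j, b) \in P then ~~ b else b | j < n].
have /CP/clause_evalPn/(_ _ lC) : ~~ clause_eval P x.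
  apply/clause_evalPn => -[j b'] /= jP; rewrite tnth_mktuple.
  case: ifP; move: jP (consP j); case: (b); case: b' => //= ->;
    by rewrite ?andbT; case: (_ \in P).
by rewrite tnth_mktuple (negbTE lP); case: (b).
Qed.

(* Besides tree-likeness, the last line is not yet used as a premise, so that *)
(* two derivations can be concatenated and their last lines resolved.         *)
Definition treelike_derivation F p C : Prop :=
  exists2 p', p = rcons p' C &
  exists2 J, justification F p J &
  uniq (premises p J) && all (fun k => k < size p') (premises p J).

Lemma treelike_derivation_input F C :
  C \in F -> treelike_derivation F [:: C] C.
Proof. by move=> CF; exists [::] => //; exists (fun=> None) => // -[]. Qed.

Lemma treelike_derivation_sub F F' p C : {subset F <= F'} ->
  treelike_derivation F p C -> treelike_derivation F' p C.
Proof.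
move=> FF' [p' pE [J JP Ju]]; exists p' => //; exists J => // k /JP.
by case: (J k) => // /FF'.
Qed.

Lemma pmap_map (T1 T2 T3 : Type) (f : T2 -> option T3) (g : T1 -> T2) s :
  pmap f (map g s) = pmap (f \o g) s.
Proof. by elim: s => //= a s ->. Qed.

Lemma pmap_omap (T1 T2 T3 : Type) (f : T1 -> option T2) (g : T2 -> T3) s :
  pmap (omap g \o f) s = map g (pmap f s).
Proof. by elim: s => //= a s ->; case: (f a). Qed.

(** The lines of [q] are shifted past those of [p]. No premise is repeated: the old ones lie
    strictly before the last line of their own block, and the two new ones are exactly these last
    lines. *)
Lemma treelike_derivation_resolvent F p q C1 C2 C :
  treelike_derivation F p C1 -> treelike_derivation F q C2 ->
  resolvent C1 C2 C -> treelike_derivation F (rcons (p ++ q) C) C.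
Proof.
move=> [p' pE [Jp JpP /andP[Jpu Jplt]]] [q' qE [Jq JqP /andP[Jqu Jqlt]]] CP.
exists (p ++ q) => //.
have sp : size p = (size p').+1 by rewrite pE size_rcons.
have sq : size q = (size q').+1 by rewrite qE size_rcons.
pose shift (ij : nat * nat) := (size p + ij.1, size p + ij.2).
pose J k := if k < size p then Jp k
  else if k < size p + size q then omap shift (Jq (k - size p))
  else Some (size p', size p + size q').
have nthp k : k < size p -> nth set0 (rcons (p ++ q) C) k = nth set0 p k.
  by move=> kp; rewrite nth_rcons size_cat ltn_addr // nth_cat kp.
have nthq k : k < size q ->
    nth set0 (rcons (p ++ q) C) (size p + k) = nth set0 q k.
  move=> kq; rewrite nth_rcons size_cat ltn_add2l kq nth_cat.
  by rewrite ltnNge leq_addr addKn.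
(* Only up to order, since [premises] lists all first premises before all second ones. *)
have prem : perm_eq (premises (rcons (p ++ q) C) J)
    (premises p Jp ++ map (addn (size p)) (premises q Jq)
       ++ [:: size p'; size p + size q']).
  rewrite /premises size_rcons size_cat -addn1 !iotaD add0n !pmap_cat.
  have -> : pmap J (iota 0 (size p)) = pmap Jp (iota 0 (size p)).
    by apply: eq_in_pmap => k; rewrite mem_iota /J => /= ->.
  have -> : pmap J (iota (size p) (size q)) =
            map shift (pmap Jq (iota 0 (size q))).
    rewrite -[X in iota X]addn0 iotaDl pmap_map -pmap_omap.
    apply: eq_in_pmap => k; rewrite mem_iota add0n /= /J => kq.
    by rewrite ltnNge leq_addr /= ltn_add2l kq addKn.
  have -> : pmap J (iota (size p + size q) 1) =
            [:: (size p', size p + size q')].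
    by rewrite /= /J ltnNge leq_addr /= ltnn.
  rewrite /unzip1 /unzip2 !map_cat /= -!map_comp.
  apply/permP => a; rewrite !count_cat /= !count_map /=.
  rewrite !addn0 /preim /=; lia.
exists J.
  move=> k; rewrite size_rcons size_cat ltnS leq_eqVlt => /orP[/eqP ->|kpq].
    rewrite /J ltnNge leq_addr /= ltnn; split; [lia|lia|].
    rewrite nthp ?[X in _ < X]sp // nthq ?[X in _ < X]sq //.
    rewrite -size_cat nth_rcons ltnn eqxx.
    by rewrite pE qE !nth_rcons !ltnn !eqxx.
  rewrite /J; case: ifPn => [kp|].
    have := JpP k kp; rewrite (nthp k kp).
    case: (Jp k) => [[i j] [ik jk]|kF //].
    by rewrite !nthp //; [exact: ltn_trans kp|exact: ltn_trans kp].
  rewrite -leqNgt => pk; rewrite kpq; have kq : k - size p < size q by lia.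
  have := JqP _ kq; rewrite -[X in nth _ (rcons _ _) X](subnKC pk) nthq //.
  case: (Jq _) => [[i j] /= [ik jk]|//].
  by rewrite !nthq; [split; [lia|lia|]|lia|lia].
rewrite (perm_uniq prem) (perm_all _ prem).
move: (premises p Jp) (premises q Jq) Jpu Jplt Jqu Jqlt => U V Uu Ult Vu Vlt.
rewrite !cat_uniq !all_cat /=.
rewrite Uu (map_inj_uniq (@addnI _)) Vu /= !inE size_cat !orbF !andbT.
apply/andP; split; last first.
  rewrite all_map; apply/and4P; split; [| |lia|lia].
    by apply: sub_all Ult => k /=; lia.
  by apply: sub_all Vlt => k /=; lia.
apply/and3P; split.
- apply/hasPn => k; rewrite mem_cat => /orP[/mapP[k' _ ->]|].
    by apply/negP => /(allP Ult); lia.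
  rewrite !inE => /orP[]/eqP->; apply/negP => /(allP Ult); lia.
- apply/norP; split.
    by apply/negP => /mapP[k _]; lia.
  by apply/negP => /mapP[k /(allP Vlt)]; lia.
- by lia.
Qed.

(** * From decision trees to refutations *)

Lemma width_cat p q : width (p ++ q) = maxn (width p) (width q).
Proof. by rewrite /width big_cat. Qed.

Lemma width_rcons p C : width (rcons p C) = maxn (width p) #|C|.
Proof. by rewrite -cats1 width_cat /width big_seq1. Qed.

(** [P] is the negated path to [A], false exactly on the inputs that reach [A]. A subclause of [P]
    is derived instead of [P] itself because there is no weakening rule. The strict size bound
    leaves room for the resolvent added at each query. *)
Lemma dtree_derivation F (A : dtree n 'I_(size F)) P :
  (forall i, ~~ (((i, true) \in P) && ((i, false) \in P))) ->
  (forall x o, ~~ clause_eval P x -> dtree_eval A x = Some o -> Search F x o) ->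
  exists p C B, [/\ treelike_derivation (F ++ B) p C, C \subset P,
    size p < 2 ^ (depth A).+1, width p <= #|P| + depth A &
    forall D x, D \in B -> ~~ clause_eval D x ->
      ~~ clause_eval P x /\ dtree_eval A x = None].
Proof.
elim: A P => [[o|]|i A0 IH0 A1 IH1] P consP AP.
- exists [:: nth set0 F o], (nth set0 F o), [::].
  have oP : nth set0 F o \subset P.
    by apply: falsified_subset => // x /AP; apply.
  split=> //; first by rewrite cats0; apply/treelike_derivation_input/mem_nth.
  by rewrite /= /width big_seq1 addn0 subset_leq_card.
- exists [:: P], P, [:: P]; split=> //.
  + by apply: treelike_derivation_input; rewrite mem_cat inE eqxx orbT.
  + by rewrite /= /width big_seq1 addn0.
  + by move=> D x; rewrite inE => /eqP ->.
rewrite [depth (Query _ _ _)]/=.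
have d0 : (depth A0).+1 <= (maxn (depth A0) (depth A1)).+1 by lia.
have d1 : (depth A1).+1 <= (maxn (depth A0) (depth A1)).+1 by lia.
have le2 := leq_pexp2l (isT : 0 < 2).
(* If the path has already queried i, only one branch is reachable, and extending [P] for the other
   one would create complementary literals. *)
have [iP|iP] := boolP ((i, true) \in P).
  have xi x : ~~ clause_eval P x -> tnth x i = false.
    by move/clause_evalPn/(_ _ iP).
  have [|p [C [B [pC CP ps pw BP]]]] := IH0 P consP.
    by move=> x o Px A0o; apply: AP => //=; rewrite xi.
  exists p, C, B; split=> //; [|by lia|].
    by apply: leq_trans ps _; apply: le2; lia.
  by move=> D x DB Dx; have [Px ?] := BP D x DB Dx; rewrite /= xi.
have [iP'|iP'] := boolP ((i, false) \in P).
  have xi x : ~~ clause_eval P x -> tnth x i = true.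
    by move/clause_evalPn/(_ _ iP').
  have [|p [C [B [pC CP ps pw BP]]]] := IH1 P consP.
    by move=> x o Px A1o; apply: AP => //=; rewrite xi.
  exists p, C, B; split=> //; [|by lia|].
    by apply: leq_trans ps _; apply: le2; lia.
  by move=> D x DB Dx; have [Px ?] := BP D x DB Dx; rewrite /= xi.
(* The branch x_i = 0 falsifies the positive literal, which therefore joins the negated path. *)
have [||p0 [C0 [B0 [pC0 CP0 ps0 pw0 BP0]]]] := IH0 ((i, true) |: P).
- move=> j; rewrite !inE /= !xpair_eqE !andbF andbT /=.
  by have [-> /=|_] := eqVneq j i; [rewrite (negbTE iP') | exact: consP].
- move=> x o; rewrite clause_evalU1 negb_or /= => /andP[xi Px] A0o.
  by apply: AP => //=; rewrite -[tnth x i]eqb_id (negbTE xi).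
have [||p1 [C1 [B1 [pC1 CP1 ps1 pw1 BP1]]]] := IH1 ((i, false) |: P).
- move=> j; rewrite !inE /= !xpair_eqE !andbF andbT /=.
  by have [-> /=|_] := eqVneq j i; [rewrite (negbTE iP) | exact: consP].
- move=> x o; rewrite clause_evalU1 negb_or /= => /andP[xi Px] A1o.
  by apply: AP => //=; case: (tnth x i) xi.
have B0P D x : D \in B0 -> ~~ clause_eval D x ->
    ~~ clause_eval P x /\ dtree_eval (Query i A0 A1) x = None.
  move=> DB Dx; have [] := BP0 D x DB Dx.
  by rewrite clause_evalU1 negb_or /= => /andP[]; case: (tnth x i).
have B1P D x : D \in B1 -> ~~ clause_eval D x ->
    ~~ clause_eval P x /\ dtree_eval (Query i A0 A1) x = None.
  move=> DB Dx; have [] := BP1 D x DB Dx.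
  by rewrite clause_evalU1 negb_or /= => /andP[]; case: (tnth x i).
have cP b : #|(i, b) |: P| = (#|P|).+1.
  by rewrite cardsU1; case: b; rewrite ?iP ?iP'.
move: pw0 pw1; rewrite !cP => pw0 pw1.
(* If one side does not use the literal on i, its clause already lies in [P] and no resolution is
   made. *)
have [iC0|iC0] := boolP ((i, true) \in C0); last first.
  exists p0, C0, B0; split=> //; last by lia.
    apply/subsetP => l lC; have /setU1P[lE|//] := subsetP CP0 l lC.
    by rewrite -lE lC in iC0.
  by apply: leq_trans ps0 _; apply: le2; lia.
have [iC1|iC1] := boolP ((i, false) \in C1); last first.
  exists p1, C1, B1; split=> //; last by lia.
    apply/subsetP => l lC; have /setU1P[lE|//] := subsetP CP1 l lC.
    by rewrite -lE lC in iC1.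
  by apply: leq_trans ps1 _; apply: le2; lia.
pose C := (C0 :\ (i, true)) :|: (C1 :\ (i, false)).
have CP : C \subset P by rewrite subUset !subDset CP0 CP1.
exists (rcons (p0 ++ p1) C), C, (B0 ++ B1); split=> //.
- apply: (@treelike_derivation_resolvent _ _ _ C0 C1).
  + apply: treelike_derivation_sub pC0 => D; rewrite !mem_cat.
    by move=> /orP[] ->; rewrite ?orbT.
  + apply: treelike_derivation_sub pC1 => D; rewrite !mem_cat.
    by move=> /orP[] ->; rewrite ?orbT.
  + by exists i, (C0 :\ (i, true)), (C1 :\ (i, false)); rewrite !setD1K.
- have := le2 _ _ d0; have := le2 _ _ d1.
  rewrite size_rcons size_cat [2 ^ _.+2]expnS; lia.
- rewrite width_rcons width_cat; have := subset_leq_card CP; lia.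
- by move=> D x; rewrite mem_cat => /orP[/B0P|/B1P]; apply.
Qed.

End Resolvents.

(** * Derivation trees with cut-off leaves *)

Section Unfolding.
Variable n : nat.
Implicit Types (x : n.-tuple bool) (C : clause n) (F : cnf n).
Implicit Types (p : seq (clause n)) (G : pred (clause n)) (w : nat).

(* A leaf [RLeaf true C] is an input clause of the refutation, and a leaf     *)
(* [RLeaf false C] is a clause that earlier queries have found to be true.    *)
Inductive rtree :=
| RLeaf of bool & clause n
| RNode of clause n & rtree & rtree.

Definition concl t := match t with RLeaf _ C => C | RNode C _ _ => C end.

Fixpoint weight t : nat :=
  match t with
  | RLeaf b _ => b
  | RNode _ t1 t2 => weight t1 + weight t2
  end.

Fixpoint valid G w t : Prop :=
  #|concl t| <= w /\
  match t with
  | RLeaf b C => b -> G C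
  | RNode C t1 t2 =>
      [/\ resolvent (concl t1) (concl t2) C, valid G w t1 & valid G w t2]
  end.

(** Singles out the inputs consistent with the earlier queries, namely those at which every cut-off
    leaf is true. *)
Fixpoint granted t x : bool :=
  match t with
  | RLeaf b C => b || clause_eval C x
  | RNode _ t1 t2 => granted t1 x && granted t2 x
  end.

Lemma valid_width G w t : valid G w t -> #|concl t| <= w.
Proof. by case: t => [b C|C t1 t2] []. Qed.

Lemma weight0_sound G w t x :
  valid G w t -> weight t = 0 -> granted t x -> clause_eval (concl t) x.
Proof.
elim: t => [[]|C t1 IH1 t2 IH2] //= [_ [Cr v1 v2]] /eqP.
rewrite addn_eq0 => /andP[/eqP w1 /eqP w2] /andP[g1 g2].
exact: resolvent_sound Cr (IH1 v1 w1 g1) (IH2 v2 w2 g2).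
Qed.

Lemma weight1_falsified G w t : valid G w t -> weight t <= 1 ->
  exists C, forall x, granted t x -> ~~ clause_eval (concl t) x ->
    G C /\ ~~ clause_eval C x.
Proof.
elim: t => [b C|C t1 IH1 t2 IH2] /=.
  by move=> [_ bG] _; exists C => x /orP[/bG|->].
move=> [_ [Cr v1 v2]] w12.
have [w1|w1] := posnP (weight t1).
- have [|D DP] := IH2 v2; first by lia.
  exists D => x /andP[g1 g2] Cx; apply: DP => //; apply: contra Cx.
  exact: resolvent_sound Cr (weight0_sound v1 w1 g1).
- have [|D DP] := IH1 v1; first by lia.
  have w2 : weight t2 = 0 by lia.
  exists D => x /andP[g1 g2] Cx; apply: DP => //; apply: contra Cx => C1.
  exact: resolvent_sound Cr C1 (weight0_sound v2 w2 g2).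
Qed.

(* The node with conclusion C is a lowest one of weight more than m, and t'   *)
(* is t with the subtree below this node cut off.                             *)
Lemma weight_split G w t m : valid G w t -> 0 < m < weight t ->
  exists C t1 t2 t', [/\ #|C| <= w, resolvent (concl t1) (concl t2) C,
    [/\ valid G w t1, valid G w t2 & valid G w t'],
    [/\ weight t1 <= m, weight t2 <= m & weight t' + m < weight t] &
    concl t' = concl t /\ forall x, granted t x ->
      [/\ granted t1 x, granted t2 x & clause_eval C x -> granted t' x]].
Proof.
move=> + /andP[m0]; elim: t => [b C|C t1 IH1 t2 IH2] /=; first by lia.
move=> [Cw [Cr v1 v2]] w12.
have [w1|w1] := ltnP m (weight t1).
  have [D [a [b [t' [Dw Dr [va vb vt'] [wa wb wt'] [ct' gt']]]]]] := IH1 v1 w1.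
  exists D, a, b, (RNode C t' t2); split=> //.
    by split=> //=; rewrite ct'.
    by split=> //=; lia.
  split=> // x /andP[/gt'[ga gb gt''] g2]; split=> //= Dx.
  by rewrite g2 gt''.
have [w2|w2] := ltnP m (weight t2).
  have [D [a [b [t' [Dw Dr [va vb vt'] [wa wb wt'] [ct' gt']]]]]] := IH2 v2 w2.
  exists D, a, b, (RNode C t1 t'); split=> //.
    by split=> //=; rewrite ct'.
    by split=> //=; lia.
  split=> // x /andP[g1 /gt'[ga gb gt'']]; split=> //= Dx.
  by rewrite g1 gt''.
(* Neither child is heavier than m, so the cut is made here; the new leaf has weight 0. *)
by exists C, t1, t2, (RLeaf false C); split=> //; split=> // x /andP[].
Qed.

(** * Searching a derivation tree by queries *)

(** The literals of [C] are queried in turn, leaving for [A1] at the first true one. *)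
Lemma dtree_test (O : Type) C (A0 A1 : dtree n O) :
  exists2 A : dtree n O, depth A <= #|C| + maxn (depth A0) (depth A1) &
    forall x,
      dtree_eval A x = dtree_eval (if clause_eval C x then A1 else A0) x.
Proof.
pose A := foldr (fun (l : literal n) A => if l.2 then Query l.1 A A1
                               else Query l.1 A1 A) A0.
have AE l s :
    A (l :: s) = if l.2 then Query l.1 (A s) A1 else Query l.1 A1 (A s).
  by [].
exists (A (enum C)).
  rewrite cardE; elim: (enum C) => [|l s]; first by rewrite add0n leq_maxl.
  by rewrite AE; case: (l.2) => /=; lia.
move=> x; have -> : clause_eval C x = has (fun l => tnth x l.1 == l.2) (enum C).
  apply/existsP/hasP => -[l].
  - by move=> /andP[lC xl]; exists l; rewrite ?mem_enum.
  - by rewrite mem_enum => lC xl; exists l; rewrite lC.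
elim: (enum C) => [|[i b] s IH] //; rewrite AE /=.
by case: b => /=; case: (tnth x i) => //=.
Qed.

(** Split at weight 2 ^ h and test the clause C of the cut node. If C is true, continue in [t'],
    which has lost more than 2 ^ h. If C is false, so is the conclusion of one child, and testing
    that of [t1] tells which to enter. Each round tests two clauses of width at most [w]. *)
Lemma rtree_search (O : Type) (out : clause n -> option O) G w t h :
  valid G w t -> weight t <= 2 ^ h ->
  exists2 A : dtree n O, depth A <= 2 * w * h &
    forall x, granted t x -> ~~ clause_eval (concl t) x ->
      exists2 C, G C /\ ~~ clause_eval C x & dtree_eval A x = out C.
Proof.
elim: h t => [|h IH] t vt wt.
  have [C CP] := weight1_falsified vt wt.
  by exists (Leaf (out C)) => // x gx Cx; exists C; first exact: CP.
have [small|big] := leqP (weight t) (2 ^ h).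
  have [A Ad AP] := IH t vt small; exists A => //.
  by apply: leq_trans Ad _; rewrite leq_mul2l leqnSn orbT.
have [|C [t1 [t2 [t' [Cw Cr [v1 v2 v'] [w1 w2 w'] [c' g']]]]]] :=
  @weight_split G w t (2 ^ h) vt; first by rewrite expn_gt0.
have [A1 A1d A1P] := IH t1 v1 w1.
have [A2 A2d A2P] := IH t2 v2 w2.
have [|A' A'd A'P] := IH t' v'; first by rewrite expnS in wt; lia.
have [A12 A12d A12P] := dtree_test (concl t1) A1 A2.
have [A Ad AP] := dtree_test C A12 A'.
exists A.
  by have := valid_width v1; rewrite mulnS; lia.
move=> x gx tx; have [g1 g2 gC] := g' x gx; rewrite AP.
case: ifPn => [Cx|Cx]; first by apply: A'P; [exact: gC | rewrite c'].
rewrite A12P; case: ifPn => [C1x|C1x]; last exact: A1P.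
by apply: A2P => //; apply: contra Cx; exact: resolvent_sound Cr C1x.
Qed.

(** * Unfolding a tree-like refutation *)

(** The premises used by the first m lines, for induction on m; at [m = size p] this is
    [premises p J]. *)
Definition premises_below (J : nat -> option (nat * nat)) m : seq nat :=
  let ij := pmap J (iota 0 m) in unzip1 ij ++ unzip2 ij.

Lemma premises_belowS J m : perm_eq (premises_below J m.+1)
  (if J m is Some (i, j) then i :: j :: premises_below J m
   else premises_below J m).
Proof.
rewrite /premises_below -addn1 iotaD add0n pmap_cat /=.
case: (J m) => [[i j]|] /=; last by rewrite cats0.
rewrite /unzip1 /unzip2 !map_cat /=; apply/permP => a.
by rewrite !count_cat /= !count_cat /=; lia.
Qed.

(* Counting only the trees of the lines that are not yet used as premises is  *)
(* what makes the sum of their weights grow by at most one per line.          *)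
Lemma treelike_unfold F p J m :
  justification F p J -> uniq (premises_below J m) -> m <= size p ->
  exists2 T : nat -> rtree,
    forall k, k < m -> [/\ valid (mem F) (width p) (T k),
      concl (T k) = nth set0 p k & forall x, granted (T k) x] &
    \sum_(k < m | (k : nat) \notin premises_below J m) weight (T k) <= m.
Proof.
move=> JP; elim: m => [|m IH] Ju mp.
  by exists (fun=> RLeaf true set0); rewrite ?big_ord0.
have nthw k : k < size p -> #|nth set0 p k| <= width p.
  by move=> kp; apply: (leq_bigmax_seq _ (mem_nth set0 kp)).
have prem := premises_belowS J m.
have Ju' := Ju; rewrite (perm_uniq prem) in Ju'.
have [|T TP Tw] := IH _ (ltnW mp).
  by move: Ju'; case: (J m) => [[i j] /= /and3P[]|].
pose t := if J m is Some (i, j) then RNode (nth set0 p m) (T i) (T j)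
          else RLeaf true (nth set0 p m).
exists (fun k => if k == m then t else T k).
  move=> k; rewrite ltnS leq_eqVlt => /orP[/eqP ->|km]; last first.
    by rewrite ltn_eqF //; apply: TP.
  rewrite eqxx /t; have := JP m mp; case: (J m) => [[i j] [im jm r]|mF] /=.
    have [vi ci gi] := TP i im; have [vj cj gj] := TP j jm.
    split=> //; last by move=> x; rewrite gi gj.
    by split; [exact: nthw | rewrite ci cj].
  by split=> //; split=> //; exact: nthw.
rewrite big_mkcond big_ord_recr -big_mkcond /= eqxx.
under eq_big => [k|k _] do [rewrite (perm_mem prem) | rewrite ltn_eqF //].
have := JP m mp; rewrite {}/t.
move: Ju'; case: (J m) => [[i j]|_ _]; last first.
  by rewrite -addn1 leq_add //; case: ifP.
rewrite /= !inE negb_or => /and3P[/andP[ij iU] jU _] [im jm _].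
rewrite (bigD1 (Ordinal im)) //= (bigD1 (Ordinal jm)) /= in Tw; last first.
  by rewrite jU -val_eqE /= eq_sym.
rewrite (eq_bigl (fun k : 'I_m =>
    (k : nat) \notin i :: j :: premises_below J m)) in Tw.
  apply: leq_trans (leqW Tw); rewrite [leqLHS]addnC [leqRHS]addnA leq_add2r.
  by case: ifP.
move=> k; rewrite !inE -!val_eqE /= !negb_or.
by do !case: (_ == _); rewrite ?andbF ?andbT.
Qed.

Lemma treelike_refutation_dtree (O : Type) (out : clause n -> option O) F p :
  treelike_refutation F p ->
  exists2 A : dtree n O, depth A <= 2 * width p * up_log 2 (size p) &
    forall x, exists2 C, C \in F /\ ~~ clause_eval C x & dtree_eval A x = out C.
Proof.
move=> [[p' pE] [J JP Ju]].
have [T TP Tw] := treelike_unfold JP Ju (leqnn _).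
have sp : size p = (size p').+1 by rewrite pE size_rcons.
have pp : size p' < size p by rewrite sp.
have [vt ct gt] := TP _ pp.
have rootNprem : size p' \notin premises_below J (size p).
  apply/negP; rewrite mem_cat => /orP[]/mapP[[i j]];
  rewrite mem_pmap => /mapP[k]; rewrite mem_iota sp => /= kp Jk e;
  have := JP k; rewrite sp -Jk -e;
  by case=> //; lia.
have [|A Ad AP] := @rtree_search _ out _ _ _ (up_log 2 (size p)) vt.
  apply: leq_trans (up_logP _ (isT : 1 < 2)); apply: leq_trans Tw.
  by rewrite (bigD1 (Ordinal pp)) //= leq_addr.
exists A => // x; apply: AP; first exact: gt.
by rewrite ct pE nth_rcons ltnn eqxx clause_eval_set0.
Qed.

End Unfolding.

(** * Push-forwards of finite distributions *)

Section Distributions.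
Variable R : realType.

Lemma PrC (T : choiceType) (D : fdist R T) (E : pred T) :
  (Pr D (predC E) = 1 - Pr D E)%R.
Proof.
rewrite -(pmf_sum1 D) [X in (_ = X - _)%R](bigID E) /= [RHS]addrC addrA.
by rewrite addNr add0r.
Qed.

Lemma Pr_le (T : choiceType) (D : fdist R T) (E E' : pred T) :
  (forall t, t \in finsupp D -> E t -> E' t) -> (Pr D E <= Pr D E')%R.
Proof.
move=> EE'; rewrite /Pr big_seq_cond [leRHS]big_seq_cond.
rewrite big_mkcond [leRHS]big_mkcond; apply: ler_sum => t _.
have [tD|//] := boolP (t \in finsupp D); rewrite /=.
case: ifPn => [/(EE' _ tD) ->//|_]; case: ifP => // _; exact: pmf_ge0.
Qed.

Lemma fdist_map (T U : choiceType) (f : T -> U) (D : fdist R T) :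
  exists2 D' : fdist R U,
    forall u, u \in finsupp D' -> exists2 t, t \in finsupp D & u = f t &
    forall E : pred U, Pr D' E = Pr D (E \o f).
Proof.
pose S := [fset f t | t in finsupp D]%fset.
pose g u : R := (\sum_(t <- finsupp D | f t == u) D t)%R.
pose h : {fsfun U -> R with 0%R} := [fsfun u in S => g u | 0%R].
have hS : (finsupp h `<=` S)%fset by apply: finsupp_sub.
have hE u : u \in S -> h u = g u by move=> uS; rewrite fsfun_fun uS.
have sumh (E : pred U) :
    (\sum_(u <- finsupp h | E u) h u = \sum_(t <- finsupp D | E (f t)) D t)%R.
  rewrite big_mkcond (big_fset_incl _ hS) /=; last first.
    by move=> u _ uh; rewrite fsfun_dflt // if_same.
  rewrite [RHS]big_mkcond (partition_big_imfset _ f) /=.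
  apply: eq_big_seq => u /hE ->; rewrite /g.
  case: ifP => Eu; last first.
    by rewrite big1 // => t /eqP ->; rewrite Eu.
  by apply: eq_bigr => t /eqP ->; rewrite Eu.
have h0 u : (0 <= h u)%R.
  rewrite fsfun_fun; case: ifP => // _.
  by apply: sumr_ge0 => t _; exact: pmf_ge0.
have h1 : (\sum_(u <- finsupp h) h u = 1)%R by rewrite sumh pmf_sum1.
exists (FDist h0 h1) => [u /=|E].
  by move=> /(fsubsetP hS)/imfsetP[t tD ->]; exists t.
by rewrite /Pr /= sumh.
Qed.

(** The push-forward of [D] along a choice function for [P]. A relation is used because the
    converted objects are only known to exist. *)
Lemma fdist_transport (T U : choiceType) (D : fdist R T) (P : T -> U -> Prop) :
  (forall t, t \in finsupp D -> exists u, P t u) ->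
  exists2 D' : fdist R U,
    forall u, u \in finsupp D' -> exists2 t, t \in finsupp D & P t u &
    forall (E : pred T) (E' : pred U),
      (forall t u, P t u -> E t -> E' u) -> (Pr D E <= Pr D' E')%R.
Proof.
move=> DP.
(* The total mass 1 makes the support nonempty; [u0] is the value of the choice function outside
   it. *)
have [u0] : inhabited U.
  have [D0|[t /DP[u _]]] := fset_0Vmem (finsupp D); last by [].
  have := pmf_sum1 D; rewrite D0 big_seq_fset0 => /eqP.
  by rewrite eq_sym oner_eq0.
have [f fP] : {f : T -> U & forall t, t \in finsupp D -> P t (f t)}.
  apply: (@choice T U (fun t u => t \in finsupp D -> P t u)) => t.
  by have [/DP[u Pu]|_] := boolP (t \in finsupp D); [exists u | exists u0].
have [D' D'f D'E] := fdist_map f D.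
exists D' => [u /D'f[t tD ->]|E E' EE']; first by exists t; last exact: fP.
by rewrite D'E; apply: Pr_le => t /fP Pt; exact: EE'.
Qed.

(** * The two conversions for a single formula *)

Lemma TFZPPdt_random_treelike_proof n (F : cnf n)
    (D : fdist R (dtree n 'I_(size F))) :
  (forall x : n.-tuple bool,
     (forall A, A \in finsupp D ->
        forall o, dtree_eval A x = Some o -> Search F x o)
     /\ (Pr D (fun A => dtree_eval A x == None) <= 1 / 3)%R) ->
  exists2 D' : fdist R (seq (clause n) * cnf n)%type,
    random_treelike_proof F D' &
    complexity D' <= 2 * (\max_(A <- finsupp D) depth A) + 1.
Proof.
move=> DF.
pose P (A : dtree n 'I_(size F)) (pB : seq (clause n) * cnf n) := [/\
  treelike_refutation (F ++ pB.2) pB.1,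
  size pB.1 < 2 ^ (depth A).+1, width pB.1 <= depth A &
  forall x, dtree_eval A x -> cnf_eval pB.2 x].
have [|D' D'P D'E] := @fdist_transport _ _ D P.
  move=> A AD.
  have [|x o _|p [C [B [[p' pE JP] CP ps pw BP]]]] :=
    @dtree_derivation n F A set0.
  - by move=> i; rewrite !inE.
  - by have [DS _] := DF x; exact: DS.
  (* The path to the root is empty, so the derived subclause is the empty clause. *)
  move: CP pw; rewrite subset0 cards0 add0n => /eqP C0 pw.
  exists (p, B); split=> //=.
    split; first by exists p'; rewrite pE C0.
    by have [J JJ /andP[Ju _]] := JP; exists J.
  move=> x Ax; apply/allP => E EB; apply: contraT => /(BP _ _ EB)[_ AN].
  by rewrite AN in Ax.
exists D'.
  split=> [pB /D'P[A _ []] //|x].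
  have [_ DN] := DF x.
  apply: le_trans (D'E (predC (fun A => dtree_eval A x == None)) _ _).
    by rewrite PrC; lra.
  move=> A pB [_ _ _ AB] /=.
  by case E: (dtree_eval A x) => // _; apply: AB; rewrite E.
have leD A : A \in finsupp D -> depth A <= \max_(A <- finsupp D) depth A.
  by move=> AD; apply: (leq_bigmax_seq _ AD).
rewrite mul2n -addnn -addnA leq_add //;
  apply/bigmax_leqP_seq => pB /D'P[A AD [_ ps pw _]] _.
  exact: leq_trans pw (leD A AD).
apply: up_log_min => //; apply: leq_trans (ltnW ps) _.
by rewrite leq_pexp2l // addn1 ltnS leD.
Qed.

Lemma random_treelike_proof_TFZPPdt n (F : cnf n)
    (D : fdist R (seq (clause n) * cnf n)%type) :
  random_treelike_proof F D ->
  exists2 D' : fdist R (dtree n 'I_(size F)),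
    (forall x : n.-tuple bool,
     (forall A, A \in finsupp D' ->
        forall o, dtree_eval A x = Some o -> Search F x o)
     /\ (Pr D' (fun A => dtree_eval A x == None) <= 1 / 3)%R) &
    \max_(A <- finsupp D') depth A <= 2 * (complexity D * complexity D).
Proof.
move=> [Dref DB].
(* A clause outside [F] has index [size F], which [insub] turns into bottom; a clause of both [F]
   and B still gives an answer. *)
pose out (C : clause n) : option 'I_(size F) := insub (index C F).
pose P (pB : seq (clause n) * cnf n) (A : dtree n 'I_(size F)) :=
  depth A <= 2 * width pB.1 * up_log 2 (size pB.1) /\
  forall x, exists2 C, C \in F ++ pB.2 /\ ~~ clause_eval C x &
    dtree_eval A x = out C.
have [pB /Dref/(treelike_refutation_dtree out)[A]|D' D'P D'E] :=
  @fdist_transport _ _ D P; first by exists A.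
exists D' => [x|].
  split=> [A /D'P[pB _ [_ /(_ x)[C [_ CF] ->]]] o|].
    rewrite /out; case: insubP => // o' lt oE [<-].
    by rewrite /Search oE nth_index // -index_mem.
  have : (Pr D (fun pB => cnf_eval pB.2 x) <=
          Pr D' (predC (fun A => dtree_eval A x == None)))%R.
    apply: D'E => pB A [_ /(_ x)[C [CFB Cx] AE]] Bx /=.
    rewrite AE /out; case: insubP => //=; rewrite index_mem => CF.
    move: CFB; rewrite mem_cat (negbTE CF) => /(allP Bx).
    by rewrite (negbTE Cx).
  by rewrite PrC; have := DB x; lra.
apply/bigmax_leqP_seq => A /D'P[pB pBD [Ad _]] _; apply: leq_trans Ad _.
rewrite -mulnA leq_mul2l /= leq_mul // /complexity.
- apply: leq_trans (leq_addr _ _).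
  by apply: (leq_bigmax_seq (F := fun pB => width pB.1) _ pBD).
- apply: leq_trans (leq_addl _ _).
  by apply: (leq_bigmax_seq (F := fun pB => up_log 2 (size pB.1)) _ pBD).
Qed.

End Distributions.

Theorem theorem1p3 (R : realType) (F : forall n, cnf n)
    (unsatF : forall n, unsatisfiable (F n))
    (widthF : polylog (fun n => width (F n))) :
  (TFZPPdt R (fun n => Search (F n)) <->
   exists2 D : forall n, fdist R (seq (clause n) * cnf n)%type,
     (forall n, random_treelike_proof (F n) (D n))
     & polylog (fun n => complexity (D n)))
  /\
  ((exists2 D : forall n, fdist R (seq (clause n) * cnf n)%type,
     (forall n, random_treelike_proof (F n) (D n))
     & polylog (fun n => complexity (D n))) <->
   exists2 D : forall n, fdist R (seq (clause n) * cnf n)%type,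
     (forall n, random_treelike_proof (F n) (D n))
     & polylog (fun n => max_width (D n)) /\ quasipoly (fun n => max_size (D n))).
Proof.
split; split.
- move=> [D Dd DF].
  (* Choice over n assembles the single distributions into a family. *)
  have D'P n := cid2 (TFZPPdt_random_treelike_proof (DF n)).
  exists (fun n => s2val (D'P n)) => [n|]; first exact: (s2valP (D'P n)).
  apply: polylog_le (fun n => s2valP' (D'P n)) _.
  by apply: polylogD (polylogM (polylog_cst 2) Dd) (polylog_cst 1).
- move=> [D DF Dc].
  have D'P n := cid2 (random_treelike_proof_TFZPPdt (DF n)).
  exists (fun n => s2val (D'P n)) => [|n]; last exact: (s2valP (D'P n)).
  apply: polylog_le (fun n => s2valP' (D'P n)) _.
  by apply: polylogM (polylog_cst 2) (polylogM Dc Dc).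
- move=> [D DF Dc]; exists D => //; split.
    by apply: polylog_le Dc => n; exact: leq_addr.
  exists (fun n => complexity (D n)) => // n.
  apply/bigmax_leqP_seq => pB pBD _.
  apply: leq_trans (up_logP _ (isT : 1 < 2)) _; rewrite leq_pexp2l //.
  apply: leq_trans (leq_addl _ _).
  by apply: (leq_bigmax_seq (F := fun pB => up_log 2 (size pB.1)) _ pBD).
- move=> [D DF [Dw [p pp Dp]]]; exists D => //.
  apply: polylog_le (polylogD Dw pp) => n; rewrite leq_add2l.
  apply/bigmax_leqP_seq => pB pBD _; apply: up_log_min => //.
  apply: leq_trans (Dp n).
  by apply: (leq_bigmax_seq (F := fun pB => size pB.1) _ pBD).
Qed.
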